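(* Suppose that the system with disturbance $\dot z=f(z,u,d)$, $z=(z_1,z_2,z_c)$, has coupled control and disturbance of the form $\dot z_1=f_1(z_1,z_c,u,d)$, $\dot z_2=f_2(z_2,z_c,u,d)$, $\dot z_c=f_c(z_c,u,d)$. Let $t<0$. If the target sets satisfy $\mathcal T=\mathrm{proj}_1^{-1}(\mathcal T_1)\cup \mathrm{proj}_2^{-1}(\mathcal T_2)$, then the maximal backward reachable tubes satisfy $$\bar{\mathcal R}(t)\supseteq\mathrm{proj}_1^{-1}(\bar{\mathcal R}_1(t))\cup \mathrm{proj}_2^{-1}(\bar{\mathcal R}_2(t)).$$
   Context: System: $z\in\mathbb R^n$ evolves by $\dot z=f(z,u,d)$ on $[t,0]$, $t<0$, with control $u\in\mathcal U\subset\mathbb R^{n_u}$ ($\mathcal U$ compact) and disturbance $d\in\mathcal D\subset\mathbb R^{n_d}$ (bounded); $f$ is uniformly continuous, bounded, and Lipschitz in $z$ for fixed $(u,d)$. Control functions $u(\cdot)$ and disturbance functions $d(\cdot)$ are measurable functions from $[t,0]$ to $\mathcal U$ and $\mathcal D$. $\zeta(s;z,t,u(\cdot),d(\cdot))$ is the unique trajectory equal to $z$ at time $t$. The disturbance is given by a non-anticipative strategy $\gamma\in\Gamma(t)$: a map $u(\cdot)\mapsto\gamma[u](\cdot)$ from control functions to disturbance functions such that whenever $u(r)=\hat u(r)$ for a.e. $r\in[t,s]$, then $\gamma[u](r)=\gamma[\hat u](r)$ for a.e. $r\in[t,s]$. State partition: $z=(z_1,z_2,z_c)$ with $z_i\in\mathbb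 R^{n_i}$, $z_c\in\mathbb R^{n_c}$, $n_1,n_2>0$, $n_c\ge 0$, $n_1+n_2+n_c=n$. Subsystem states are $x_i=(z_i,z_c)$, $i=1,2$. Subsystem $i$ has dynamics $\dot z_i=f_i(z_i,z_c,u,d)$, $\dot z_c=f_c(z_c,u,d)$ with trajectory $\xi_i(s;x_i,t,u(\cdot),d(\cdot))$ equal to $x_i$ at time $t$. Back-projection: for $S_i\subseteq\mathbb R^{n_i+n_c}$, $\mathrm{proj}_i^{-1}(S_i)=\{z\in\mathbb R^n:(z_i,z_c)\in S_i\}$. Target sets: $\mathcal T\subseteq\mathbb R^n$, $\mathcal T_i\subseteq\mathbb R^{n_i+n_c}$. Maximal backward reachable tubes: $\bar{\mathcal R}(t)=\{z:\forall\gamma\in\Gamma(t),\ \exists u(\cdot),\ \exists s\in[t,0],\ \zeta(s;z,t,u(\cdot),\gamma[u](\cdot))\in\mathcal T\}$ and $\bar{\mathcal R}_i(t)=\{x_i:\forall\gamma\in\Gamma(t),\ \exists u(\cdot),\ \exists s\in[t,0],\ \xi_i(s;x_i,t,u(\cdot),\gamma[u](\cdot))\in\mathcal T_i\}$.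
   Formalization: The Lipschitz constant of f in z is taken to be the same for all u and d in their sets; with a constant depending on (u,d), trajectories need not be unique, so the ''unique trajectory'' would be undefined. *)

(* Defs.v *)
From HB Require Import structures.
From mathcomp Require Import all_boot all_order all_algebra.
From mathcomp Require Import all_classical all_reals all_analysis.

Set Implicit Arguments.
Unset Strict Implicit.
Unset Printing Implicit Defensive.

Import Order.TTheory GRing.Theory Num.Theory.
Import numFieldNormedType.Exports.

Local Open Scope classical_set_scope.
Local Open Scope ring_scope.

Section ControlSystem.
Context {R : realType} {n nu nd : nat}.

(* Only the values [g z u d] with [u] in [U] and [d] in [D] are meaningful. *)
Definition dynamics := 'rV[R]_n -> 'rV[R]_nu -> 'rV[R]_nd -> 'rV[R]_n.

Implicit Types (g : dynamics) (U : set 'rV[R]_nu) (D : set 'rV[R]_nd).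

Definition unif_continuous_on U D g : Prop :=
  forall e : R, 0 < e -> exists2 delta : R, 0 < delta &
    forall z z' u u' d d', U u -> U u' -> D d -> D d' ->
      `|z - z'| < delta -> `|u - u'| < delta -> `|d - d'| < delta ->
      `|g z u d - g z' u' d'| < e.

Definition bounded_on U D g : Prop :=
  exists M : R, forall z u d, U u -> D d -> `|g z u d| <= M.

(* The constant does not depend on [u] and [d]: with a constant depending on
   them, trajectories need not be unique. *)
Definition lipschitz_in_state U D g : Prop :=
  exists L : R, forall u d, U u -> D d -> L.-lipschitz (fun z => g z u d).

(* Vector-valued measurability is measurability of every coordinate.  Functions
   on [t, 0] are represented by functions on R whose values outside [t, 0] are
   irrelevant. *)
Definition signal m (V : set 'rV[R]_m) (t : R) : set (R -> 'rV[R]_m) :=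
  [set v : R -> 'rV[R]_m |
     (forall i, measurable_fun `[t, 0] (fun r => v r 0 i)) /\
     (forall r, r \in `[t, 0] -> V (v r))].

Definition strategy U D (t : R) :
    set ((R -> 'rV[R]_nu) -> (R -> 'rV[R]_nd)) :=
  [set gamma : (R -> 'rV[R]_nu) -> (R -> 'rV[R]_nd) |
    (forall u, signal U t u -> signal D t (gamma u)) /\
    (forall u u' (s : R), signal U t u -> signal U t u' -> s \in `[t, 0] ->
      {ae lebesgue_measure, forall r : R, r \in `[t, s] -> u r = u' r} ->
      {ae lebesgue_measure, forall r : R, r \in `[t, s] ->
        gamma u r = gamma u' r})].

(* Solution on [t, 0] in the sense of Caratheodory of
   x' = g (x, u, d), x(t) = z, in integral form. *)
Definition is_trajectory g (t : R) (z : 'rV[R]_n) (u : R -> 'rV[R]_nu)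
    (d : R -> 'rV[R]_nd) (x : R -> 'rV[R]_n) : Prop :=
  forall i,
    lebesgue_measure.-integrable `[t, 0]
      (fun r => (g (x r) (u r) (d r) 0 i)%:E) /\
    (forall s, s \in `[t, 0] ->
      x s 0 i = z 0 i +
        \int[lebesgue_measure]_(r in `[t, s]) g (x r) (u r) (d r) 0 i).

(* The trajectory, by definite description; the default value [cst z] is only
   used when there is no trajectory. *)
Definition trajectory g (t : R) (z : 'rV[R]_n) (u : R -> 'rV[R]_nu)
    (d : R -> 'rV[R]_nd) : R -> 'rV[R]_n :=
  xget (cst z) [set x | is_trajectory g t z u d x].

Definition max_brt g U D (T : set 'rV[R]_n) (t : R) : set 'rV[R]_n :=
  [set z | forall gamma, strategy U D t gamma ->
    exists u, signal U t u /\
      exists2 s : R, s \in `[t, 0] & T (trajectory g t z u (gamma u) s)].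

End ControlSystem.

Arguments dynamics : clear implicits.

Section Decomposition.
Context {R : realType} {n1 n2 nc nu nd : nat}.

(* A state is z = row_mx (row_mx z1 z2) zc, a state of subsystem i is
   row_mx zi zc. *)
Definition state1 (z : 'rV[R]_(n1 + n2 + nc)) : 'rV[R]_n1 :=
  lsubmx (lsubmx z).
Definition state2 (z : 'rV[R]_(n1 + n2 + nc)) : 'rV[R]_n2 :=
  rsubmx (lsubmx z).
Definition statec (z : 'rV[R]_(n1 + n2 + nc)) : 'rV[R]_nc := rsubmx z.

Definition back_proj1 (S : set 'rV[R]_(n1 + nc)) : set 'rV[R]_(n1 + n2 + nc) :=
  [set z | S (row_mx (state1 z) (statec z))].
Definition back_proj2 (S : set 'rV[R]_(n2 + nc)) : set 'rV[R]_(n1 + n2 + nc) :=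
  [set z | S (row_mx (state2 z) (statec z))].

Definition coupled_form (U : set 'rV[R]_nu) (D : set 'rV[R]_nd)
    (f : dynamics R (n1 + n2 + nc) nu nd)
    (f1 : 'rV[R]_n1 -> 'rV[R]_nc -> 'rV[R]_nu -> 'rV[R]_nd -> 'rV[R]_n1)
    (f2 : 'rV[R]_n2 -> 'rV[R]_nc -> 'rV[R]_nu -> 'rV[R]_nd -> 'rV[R]_n2)
    (fc : 'rV[R]_nc -> 'rV[R]_nu -> 'rV[R]_nd -> 'rV[R]_nc) : Prop :=
  forall z u d, U u -> D d ->
    [/\ state1 (f z u d) = f1 (state1 z) (statec z) u d,
        state2 (f z u d) = f2 (state2 z) (statec z) u d &
        statec (f z u d) = fc (statec z) u d].

End Decomposition.

Definition subsystem {R : realType} {m nc nu nd : nat}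
    (fi : 'rV[R]_m -> 'rV[R]_nc -> 'rV[R]_nu -> 'rV[R]_nd -> 'rV[R]_m)
    (fc : 'rV[R]_nc -> 'rV[R]_nu -> 'rV[R]_nd -> 'rV[R]_nc) :
    dynamics R (m + nc) nu nd :=
  fun x u d => row_mx (fi (lsubmx x) (rsubmx x) u d) (fc (rsubmx x) u d).

(* Main.v *)
Require Import Defs.
From mathcomp Require Import all_boot all_order all_algebra.
From mathcomp Require Import all_classical all_reals all_analysis.
From mathcomp Require Import measurable_realfun ring lra.
Import Order.TTheory GRing.Theory Num.Theory.
Import numFieldNormedType.Exports.
Local Open Scope classical_set_scope.
Local Open Scope ring_scope.

(** A strategy for the full system is at the same time a strategy for each
    subsystem, because both receive the same controls and disturbances. If the
    projection of [z] lies in the tube of a subsystem and a strategy is given,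
    the subsystem thus supplies a control and a time at which its trajectory is
    in its own target. The same control works for the full system as soon as
    the subsystem trajectory is the projection of the full trajectory, since a
    state whose projection is in the small target is in the full one.

    The projection of a solution of the full system solves the subsystem, so
    the two trajectories agree provided that the full system has a solution
    ([trajectory_exists]) and that the subsystem has at most one
    ([trajectory_unique]). Existence matters because [trajectory] falls
    back to a constant curve when there is no solution. Both facts come from the Picard
    map, measured with the weight [expR (K * (s - t))], where [K] is twice a
    bound of the Lipschitz constant: integration against this weight gains a
    factor [1/K], so the Picard map halves weighted distances on the whole of
    [[t, 0]] at once ([integral_half_contraction]). Two solutions are fixed
    points, hence equal; the iterates converge pointwise, and dominated
    convergence turns their limit into a solution. The iteration needs the
    velocity along a measurable curve to be measurable in time, which follows
    from the uniform continuity of the dynamics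
    ([measurable_unif_cont_family]).

    Projections are handled as selections of coordinates [colsub sigma] with
    [sigma] injective. The subsystem inherits boundedness and the Lipschitz
    property because a state of it extends by zero to a full state, without
    increasing distances. *)

(** * Coordinates of vectors *)

Lemma norm_coord_le (R : realType) (n : nat) (z : 'rV[R]_n) i :
  `|z 0 i| <= `|z|.
Proof.
rewrite {2}/Num.Def.normr/= mx_normrE.
by apply: (le_bigmax _ (fun ij => `|z ij.1 ij.2|) (0, i)).
Qed.

Lemma norm_coordB_le (R : realType) (n : nat) (z z' : 'rV[R]_n) i :
  `|z 0 i - z' 0 i| <= `|z - z'|.
Proof. by have := norm_coord_le _ _ (z - z') i; rewrite !mxE. Qed.

Lemma norm_le_coord (R : realType) (n : nat) (z : 'rV[R]_n) (c : R) :
  0 <= c -> (forall i, `|z 0 i| <= c) -> `|z| <= c.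
Proof.
move=> c0 zc; rewrite /Num.Def.normr/= mx_normrE; apply/bigmax_leP.
by split=> // -[i j] _ /=; rewrite ord1.
Qed.

Lemma norm_lt_coord (R : realType) (n : nat) (z : 'rV[R]_n) (c : R) :
  0 < c -> (forall i, `|z 0 i| < c) -> `|z| < c.
Proof.
move=> c0 zc; rewrite /Num.Def.normr/= mx_normrE; apply/bigmax_ltP.
by split=> // -[i j] _ /=; rewrite ord1.
Qed.

Lemma cvg_norm_coord (R : realType) (n : nat) (v : nat -> 'rV[R]_n)
    (a : 'rV[R]_n) :
  (forall i, (fun k => v k 0 i) @ \oo --> a 0 i) -> v @ \oo --> a.
Proof.
move=> va; apply/cvgrPdist_lt => e e0.
have : \forall k \near \oo, forall i, `|a 0 i - v k 0 i| < e.
  by apply: filter_forall => i; have /cvgrPdist_lt := va i; apply.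
by apply: filterS => k close; apply: norm_lt_coord => // i; rewrite !mxE.
Qed.

(** * Measurability and integrals *)

(** The hypothesis makes [H] a uniformly continuous function of the vector of
    the [w j], on the range of that vector only, so that the controls and disturbances may
    take their values in arbitrary sets. Cut the
    values of the [w j] into countably many grid cells of every size [1/(k+1)].
    By continuity each point where [H] exceeds [a] has a fine enough cell on
    which [H] exceeds [a], so that superlevel sets are countable unions of
    preimages of cells. *)
Lemma measurable_unif_cont_family (R : realType) d (T : measurableType d)
    (J : finType) (I : set T) (w : J -> T -> R) (H : T -> R) :
  measurable I -> (forall j, measurable_fun I (w j)) ->
  (forall e : R, 0 < e -> exists2 delta : R, 0 < delta &
    forall r r', I r -> I r' -> (forall j, `|w j r - w j r'| < delta) ->
      `|H r - H r'| < e) ->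
  measurable_fun I H.
Proof.
move=> mI mw ucH _; apply: (measurability _ (RGenOInfty.measurableE R)) => //.
move=> _ [_ [a ->] <-].
pose cell (kc : nat * {ffun J -> int}) : set T := I `&` \bigcap_(j in [set: J])
  (I `&` w j @^-1` [set` `[(kc.2 j)%:~R / kc.1.+1%:R,
                       (kc.2 j + 1)%:~R / kc.1.+1%:R[ ]).
have mcell kc : measurable (cell kc).
  apply: measurableI => //; apply: fin_bigcap_measurable => // j _.
  by apply: mw => //; exact: measurable_itv.
(* The union ranges over all cells: those leaving the superlevel set count as
   empty. *)
pose F kc := if `[< cell kc `<=` [set r | a < H r] >] then cell kc else set0.
rewrite (_ : _ `&` _ = \bigcup_kc F kc).
  apply: countable_bigcupT_measurable; first exact: countableP.
  by move=> kc; rewrite /F; case: ifPn.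
apply/seteqP; split=> [r /= [Ir]|r [kc _]].
  rewrite in_itv/= andbT => aH.
  have [|delta d0 dH] := ucH (H r - a); first by rewrite subr_gt0.
  have [k] := ltr_add_invr d0; rewrite add0r => kd.
  have k0 : 0 < k.+1%:R :> R by rewrite ltr0n.
  pose c := [ffun j => Num.floor (w j r * k.+1%:R)].
  have cr : cell (k, c) r.
    split=> // j _; split=> //=; rewrite in_itv/= ffunE.
    by rewrite ler_pdivrMr// ltr_pdivlMr// floor_itv.
  exists (k, c) => //; rewrite /F; case: ifPn => // /asboolPn; case.
  move=> r' [Ir' cr'] /=; suff : `|H r - H r'| < H r - a.
    by move/(le_lt_trans (ler_norm _)); rewrite ltrD2l ltrN2.
  apply: dH => // j; apply: le_lt_trans kd.
  have [_ /(_ j Logic.I)[_]] := cr; have [_] := cr' j Logic.I.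
  rewrite /= !in_itv/=.
  rewrite intrD mulr1z mulrDl mul1r => /andP[l1 u1] /andP[l2 u2].
  rewrite ler_norml; apply/andP; split; move: l1 u1 l2 u2;
    by move: (k.+1%:R^-1) => b; lra.
rewrite /F; case: ifPn => // /asboolP cH cr; split; first by case: cr.
by rewrite /= in_itv/= andbT; exact: cH.
Qed.

Lemma integrable_bounded_itv (R : realType) (b0 b1 : bool) (a b M : R)
    (f : R -> R) :
  measurable_fun [set` Interval (BSide b0 a) (BSide b1 b)] f ->
  (forall r, r \in Interval (BSide b0 a) (BSide b1 b) -> `|f r| <= M) ->
  lebesgue_measure.-integrable [set` Interval (BSide b0 a) (BSide b1 b)]
    (EFin \o f).
Proof.
move=> mf fM; apply: measurable_bounded_integrable => //=.
  by rewrite lebesgue_measure_itv/=; case: ifP => // _; rewrite -EFinB ltry.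
exists M; split; first exact: num_real.
by move=> A MA r /fM /le_trans; apply; exact: ltW.
Qed.

Lemma is_derive_weight (R : realType) (K t r : R) :
  is_derive r 1 (fun x : R => expR (K * (x - t))) (K * expR (K * (r - t))).
Proof.
apply: is_derive_eq.
by rewrite /= subr0 mulrC [_ *: _]mulr1.
Qed.

Lemma continuous_weight (R : realType) (K t : R) :
  continuous (fun r : R => expR (K * (r - t))).
Proof.
move=> r; apply: differentiable_continuous; apply/derivable1_diffP.
by case: (is_derive_weight R K t r).
Qed.

Lemma integral_weight_le (R : realType) (K t s : R) : t <= s ->
  \int[lebesgue_measure]_(r in `[t, s]) (K * expR (K * (r - t)))
    <= expR (K * (s - t)).
Proof.
rewrite le_eqVlt => /predU1P[<-|ts].
  by rewrite set_itv1 Rintegral_set1 expR_ge0.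
pose F r := expR (K * (r - t)).
have cF : continuous F by exact: continuous_weight.
rewrite /Rintegral (@continuous_FTC2 _ _ F)//=.
- by rewrite /F subrr mulr0 expR0 lerBlDr lerDl.
- apply: continuous_subspaceT => x; apply: cvgM; first exact: cvg_cst.
  exact: cF.
- split; first by move=> x _; case: (is_derive_weight R K t x).
  by apply/cvg_at_right_filter; exact: cF.
  by apply/cvg_at_left_filter; exact: cF.
- by move=> x _; rewrite derive1E; have [_ ->] := is_derive_weight R K t x.
Qed.

(** Integrating the weight gains the factor [1/K]: this is what makes the Picard
    map a contraction with a ratio that does not depend on the length of the
    time interval. *)
Lemma integral_half_contraction (R : realType) (K C t : R) (p q : R -> R) :
  0 <= C ->
  lebesgue_measure.-integrable `[t, 0] (EFin \o p) ->
  lebesgue_measure.-integrable `[t, 0] (EFin \o q) ->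
  (forall r, r \in `[t, 0] ->
    `|p r - q r| <= C * (K / 2) * expR (K * (r - t))) ->
  forall s, s \in `[t, 0] ->
  `| \int[lebesgue_measure]_(r in `[t, s]) p r -
     \int[lebesgue_measure]_(r in `[t, s]) q r| <= C / 2 * expR (K * (s - t)).
Proof.
move=> C0 ip iq pq s; rewrite in_itv/= => /andP[ts s0].
have sub : `[t, s] `<=` `[t, (0 : R)] by apply: subset_itvl.
have {}ip : lebesgue_measure.-integrable `[t, s] (EFin \o p).
  exact: integrableS ip.
have {}iq : lebesgue_measure.-integrable `[t, s] (EFin \o q).
  exact: integrableS iq.
have iw : lebesgue_measure.-integrable `[t, s]
    (EFin \o (fun r : R => K * expR (K * (r - t)))).
  apply: continuous_compact_integrable; first exact: segment_compact.
  apply: continuous_subspaceT => x; apply: cvgM; first exact: cvg_cst.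
  exact: continuous_weight.
rewrite -RintegralB//.
have ipq : lebesgue_measure.-integrable `[t, s] (EFin \o (fun r => p r - q r)).
  by have := integrableB _ ip iq; apply.
apply: (le_trans (le_normr_Rintegral _ _)) => //.
apply: (@le_trans _ _ (\int[lebesgue_measure]_(r in `[t, s])
    (C / 2 * (K * expR (K * (r - t)))))).
  apply: le_Rintegral => //.
  - by have := integrable_norm ipq; apply.
  - by have := integrableZl _ (C / 2) iw; apply.
  - move=> r /sub /pq.
    have -> // : C * (K / 2) * expR (K * (r - t)) =
      C / 2 * (K * expR (K * (r - t))) by ring.
rewrite RintegralZl// ler_wpM2l//; first by rewrite divr_ge0.
exact: integral_weight_le.
Qed.

(** * Existence and uniqueness of solutions *)

Lemma le0_geometric (R : realType) (e c : R) :
  (forall k, e <= c / 2 ^+ k) -> e <= 0.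
Proof.
move=> ec; have h : `|2^-1 : R| < 1 by rewrite ger0_norm// invf_lt1// ltr1n.
have cvg0 := cvg_geometric c h.
rewrite -(cvg_lim (@Rhausdorff R) cvg0); apply: limr_ge; first exact: cvgP cvg0.
by apply: nearW => k; rewrite /geometric/= exprVn.
Qed.

Section CaratheodorySolutions.
Context {R : realType} {n nu nd : nat}.
Context (g : dynamics R n nu nd) (t : R) (z : 'rV[R]_n).
Context (u : R -> 'rV[R]_nu) (d : R -> 'rV[R]_nd).

Definition velocity (x : R -> 'rV[R]_n) (i : 'I_n) (r : R) : R :=
  g (x r) (u r) (d r) 0 i.

Definition picard (x : R -> 'rV[R]_n) (s : R) : 'rV[R]_n :=
  \row_i (z 0 i + \int[lebesgue_measure]_(r in `[t, s]) velocity x i r).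

Definition integrable_velocity (x : R -> 'rV[R]_n) : Prop :=
  forall i, lebesgue_measure.-integrable `[t, 0] (EFin \o velocity x i).

Lemma trajectory_picard x : is_trajectory g t z u d x ->
  integrable_velocity x /\ forall s, s \in `[t, 0] -> x s = picard x s.
Proof.
move=> xP; split=> [i|s st]; first by have [] := xP i.
by apply/rowP => i; rewrite mxE; have [_ ->] := xP i.
Qed.

Lemma picard_trajectory x : integrable_velocity x ->
  (forall s, s \in `[t, 0] -> x s = picard x s) -> is_trajectory g t z u d x.
Proof.
by move=> ix xE i; split=> [|s /xE {1}->]; [exact: ix|rewrite mxE].
Qed.

Lemma picard_contract (K C : R) x y : 0 <= C ->
  integrable_velocity x -> integrable_velocity y ->
  (forall r, r \in `[t, 0] ->
    `|g (x r) (u r) (d r) - g (y r) (u r) (d r)|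
      <= C * (K / 2) * expR (K * (r - t))) ->
  forall s, s \in `[t, 0] ->
    `|picard x s - picard y s| <= C / 2 * expR (K * (s - t)).
Proof.
move=> C0 ix iy xy s st; apply: norm_le_coord => [|i].
  by rewrite mulr_ge0 ?expR_ge0// divr_ge0.
rewrite !mxE opprD addrACA subrr add0r.
apply: integral_half_contraction => // r rt.
by apply: le_trans (xy r rt); exact: norm_coordB_le.
Qed.

Context (M L : R)
  (g_bounded : forall a r, r \in `[t, 0] -> `|g a (u r) (d r)| <= M)
  (g_lipschitz : forall a b r, r \in `[t, 0] ->
    `|g a (u r) (d r) - g b (u r) (d r)| <= L * `|a - b|).

(* Twice a positive Lipschitz constant: the factor 2 yields the ratio 1/2. *)
Let K : R := 2 * (`|L| + 1).

Let K_gt0 : 0 < K.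
Proof. by rewrite mulr_gt0// ltr_wpDl. Qed.

(* Chosen so that [C * (K / 2)] is [2 * `|M|], which bounds the difference of
   two velocities. *)
Let C : R := 4 * `|M| / K.

Let C_ge0 : 0 <= C.
Proof. by rewrite divr_ge0 ?mulr_ge0// ltW. Qed.

Let picard_lipschitz (c : R) x y : 0 <= c ->
  integrable_velocity x -> integrable_velocity y ->
  (forall s, s \in `[t, 0] -> `|x s - y s| <= c * expR (K * (s - t))) ->
  forall s, s \in `[t, 0] ->
    `|picard x s - picard y s| <= c / 2 * expR (K * (s - t)).
Proof.
move=> c0 ix iy xy; apply: picard_contract => // r rt.
have -> : c * (K / 2) * expR (K * (r - t)) =
    (`|L| + 1) * (c * expR (K * (r - t))) by rewrite /K; field.
apply: le_trans (g_lipschitz _ _ _ rt) _.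
apply: (@le_trans _ _ ((`|L| + 1) * `|x r - y r|)).
  by rewrite ler_wpM2r// ler_wpDr// ler_norm.
by rewrite ler_wpM2l ?xy// addr_ge0.
Qed.

Let picard_bounded x y : integrable_velocity x -> integrable_velocity y ->
  forall s, s \in `[t, 0] ->
    `|picard x s - picard y s| <= C * expR (K * (s - t)).
Proof.
move=> ix iy s st.
apply: (@le_trans _ _ (C / 2 * expR (K * (s - t)))); last first.
  by rewrite ler_wpM2r ?expR_ge0// ler_pdivrMr// ler_peMr// ler1n.
apply: picard_contract => // r rt.
have -> : C * (K / 2) = 2 * `|M|.
  by rewrite /C; field; rewrite gt_eqF.
apply: (@le_trans _ _ (2 * `|M|)); last first.
  rewrite ler_peMr ?mulr_ge0// -expR0 ler_expR mulr_ge0 ?(ltW K_gt0)//.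
  by rewrite subr_ge0; move: rt; rewrite in_itv => /andP[].
apply: (le_trans (ler_normB _ _)); rewrite mulr2n mulrDl !mul1r.
by apply: lerD; apply: le_trans (ler_norm M); exact: g_bounded.
Qed.

(** Solutions are fixed points of the Picard map, so the bound on their weighted
    distance can be halved forever. *)
Lemma trajectory_unique x y :
  is_trajectory g t z u d x -> is_trajectory g t z u d y ->
  forall s, s \in `[t, 0] -> x s = y s.
Proof.
move=> /trajectory_picard[ix xE] /trajectory_picard[iy yE].
have xy k s : s \in `[t, 0] -> `|x s - y s| <= C / 2 ^+ k * expR (K * (s - t)).
  elim: k s => [|k IH] s st; rewrite xE// yE//.
    by rewrite expr0 divr1; exact: picard_bounded.
  have -> : C / 2 ^+ k.+1 = C / 2 ^+ k / 2.
    by rewrite exprSr invfM mulrA.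
  by apply: picard_lipschitz => //; rewrite divr_ge0.
move=> s st; apply/eqP; rewrite -subr_eq0 -normr_le0.
apply: (@le0_geometric _ _ (C * expR (K * (s - t)))) => k.
by rewrite mulrAC; exact: xy.
Qed.

Context (velocity_measurable : forall x : R -> 'rV[R]_n,
  (forall i, measurable_fun `[t, 0] (fun r => x r 0 i)) ->
  forall i, measurable_fun `[t, 0] (velocity x i)).

Lemma velocity_integrable (x : R -> 'rV[R]_n) :
  (forall i, measurable_fun `[t, 0] (fun r => x r 0 i)) ->
  integrable_velocity x.
Proof.
move=> mx i; apply: (@integrable_bounded_itv _ _ _ _ _ M).
  exact: velocity_measurable.
by move=> r rt; exact: le_trans (norm_coord_le _ _ _ _) (g_bounded _ _ rt).
Qed.

(** As the velocity is bounded, the Picard image is Lipschitz in time, hence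
    measurable. *)
Lemma picard_measurable x : integrable_velocity x ->
  forall i, measurable_fun `[t, 0] (fun r => picard x r 0 i).
Proof.
move=> ix i.
have lipP r r' : t <= r -> r <= r' -> r' <= 0 ->
    `|picard x r' 0 i - picard x r 0 i| <= `|M| * (r' - r).
  move=> tr rr' r'0; rewrite !mxE opprD addrACA subrr add0r.
  have ixr' : lebesgue_measure.-integrable `[t, r'] (EFin \o velocity x i).
    by apply: integrableS (ix i) => //; exact: subset_itvl.
  have ixr : lebesgue_measure.-integrable `]r, r'] (EFin \o velocity x i).
    by apply: integrableS ixr' => //; exact: subset_itvr.
  rewrite Rintegral_itvB//.
  apply: (le_trans (le_normr_Rintegral _ _)) => //.
  have -> : `|M| * (r' - r) = \int[lebesgue_measure]_(_ in `]r, r']) `|M|.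
    rewrite Rintegral_cst//= lebesgue_measure_itv/= lte_fin.
    by move: rr'; rewrite le_eqVlt => /predU1P[->|->//]; rewrite ?ltxx subrr.
  apply: le_Rintegral => //.
  - by have := integrable_norm ixr; apply.
  - apply: (@integrable_bounded_itv _ _ _ _ _ `|M|) => // v _.
    by rewrite normr_id.
  - move=> v /=; rewrite in_itv/= => /andP[rv vr'].
    apply: le_trans (norm_coord_le _ _ _ _) _.
    apply: le_trans (ler_norm M); apply: g_bounded.
    by rewrite in_itv/= (le_trans tr (ltW rv)) (le_trans vr').
apply: (@measurable_unif_cont_family _ _ _ unit _ (fun=> id)) => //.
move=> e e0; exists (e / (`|M| + 1)).
  by rewrite divr_gt0// ltr_wpDl.
move=> r r' /=; rewrite !in_itv/= => /andP[tr r0] /andP[tr' r'0] /(_ tt).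
rewrite ltr_pdivlMr ?ltr_wpDl// => rr'; apply: le_lt_trans rr'.
apply: (@le_trans _ _ (`|M| * `|r - r'|)); last first.
  by rewrite mulrC ler_wpM2l// lerDl.
have [le|/ltW le] := leP r r'.
- by rewrite distrC (distrC r) [X in _ * X]ger0_norm ?subr_ge0// lipP.
- by rewrite [X in _ * X]ger0_norm ?subr_ge0// lipP.
Qed.

Let iterate (k : nat) : R -> 'rV[R]_n := iter k picard (cst z).

Let iterate_integrable k : integrable_velocity (iterate k).
Proof.
apply: velocity_integrable; elim: k => [|k IH] i.
  exact: measurable_cst.
by apply: picard_measurable; exact: velocity_integrable.
Qed.

(* The indices start at 1: the bound [C] needs both curves to be Picard
   images. *)
Let iterate_close k s : s \in `[t, 0] ->
  `|iterate k.+2 s - iterate k.+1 s| <= C / 2 ^+ k * expR (K * (s - t)).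
Proof.
elim: k s => [|k IH] s st.
  by rewrite expr0 divr1; exact: (@picard_bounded (iterate 1) (iterate 0)).
have -> : C / 2 ^+ k.+1 = C / 2 ^+ k / 2.
  by rewrite exprSr invfM mulrA.
apply: (@picard_lipschitz _ (iterate k.+2) (iterate k.+1)) => //.
by rewrite divr_ge0.
Qed.

Let iterate_cvg s i : s \in `[t, 0] -> cvgn (fun k => iterate k.+1 s 0 i).
Proof.
move=> st; pose v k := iterate k.+1 s 0 i.
have -> : (fun k => iterate k.+1 s 0 i) = (cst (v 0%N) \+ series (telescope v)).
  by apply/funext => k; rewrite /= -(eq_sum_telescope v).
apply: is_cvgD; first exact: is_cvg_cst.
apply: normed_cvg.
have h : `|2^-1 : R| < 1 by rewrite ger0_norm// invf_lt1// ltr1n.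
apply: (@series_le_cvg _ _ (geometric (C * expR (K * (s - t))) 2^-1))
  => [k|k|k|].
- exact: normr_ge0.
- by apply: mulr_ge0 => //; exact: mulr_ge0 C_ge0 (expR_ge0 _).
- rewrite [leRHS]/= exprVn mulrAC.
  by apply: le_trans (iterate_close k _ st); exact: norm_coordB_le.
- exact: is_cvg_geometric_series.
Qed.

Let solution (s : R) : 'rV[R]_n := \row_i limn (fun k => iterate k.+1 s 0 i).

Let solution_cvg s i : s \in `[t, 0] ->
  (fun k => iterate k.+1 s 0 i) @ \oo --> solution s 0 i.
Proof. by move=> st; rewrite mxE; exact: iterate_cvg. Qed.

Let solution_integrable : integrable_velocity solution.
Proof.
apply: velocity_integrable => i.
apply: (@measurable_fun_cvg _ _ _ _ (fun k s => iterate k.+1 s 0 i)).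
  by move=> k; apply: picard_measurable; exact: iterate_integrable.
by move=> s /= st; exact: solution_cvg.
Qed.

Let velocity_cvg s i : s \in `[t, 0] ->
  (fun k => velocity (iterate k.+1) i s) @ \oo --> velocity solution i s.
Proof.
move=> st; have sol : (fun k => iterate k.+1 s) @ \oo --> solution s.
  by apply: cvg_norm_coord => i0; exact: solution_cvg.
apply/cvgrPdist_lt => e e0.
have e'0 : 0 < e / (`|L| + 1) by rewrite divr_gt0// ltr_wpDl.
have /cvgrPdist_lt/(_ _ e'0) := sol; apply: filterS => k.
rewrite ltr_pdivlMr ?ltr_wpDl//; apply: le_lt_trans.
apply: (le_trans (norm_coordB_le _ _ _ _ _)).
apply: le_trans (g_lipschitz _ _ _ st) _.
by rewrite mulrC ler_wpM2l// ler_wpDr// ler_norm.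
Qed.

(** The Picard iterates converge geometrically, and since the velocities along
    them are bounded by [M], dominated convergence lets their integral equations
    pass to the limit. *)
Lemma trajectory_exists : exists x, is_trajectory g t z u d x.
Proof.
exists solution; apply: picard_trajectory => // s st.
apply/rowP => i.
have sub : `[t, s] `<=` `[t, (0 : R)].
  by apply: subset_itvl; move: st; rewrite in_itv/= => /andP[].
have iX k : lebesgue_measure.-integrable `[t, s]
    (EFin \o velocity (iterate k) i).
  by apply: integrableS (iterate_integrable k i).
have iS : lebesgue_measure.-integrable `[t, s] (EFin \o velocity solution i).
  by apply: integrableS (solution_integrable i).
have iM : lebesgue_measure.-integrable `[t, s] (EFin \o cst M).
  exact: (@integrable_bounded_itv _ _ _ _ _ `|M|).
have lim2 : (fun k => iterate k.+2 s 0 i) @ \oo --> picard solution s 0 i.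
  rewrite /= mxE; under eq_fun do rewrite mxE.
  apply: cvgD; first exact: cvg_cst.
  apply: fine_cvg; rewrite fineK; last exact: integrable_fin_num.
  have [] := @dominated_convergence _ _ _ lebesgue_measure `[t, s]
    (measurable_itv _) (fun k => EFin \o velocity (iterate k.+1) i)
    (EFin \o velocity solution i) (EFin \o cst M) _ _ _ iM.
  - by move=> k; exact: measurable_int (iX k.+1).
  - exact: measurable_int iS.
  - apply: aeW => r /= /sub rt; apply: cvg_EFin; first exact: nearW.
    exact: velocity_cvg.
  - apply: aeW => r k /= /sub rt; rewrite lee_fin.
    exact: le_trans (norm_coord_le _ _ _ _) (g_bounded _ _ rt).
  - by move=> _ _.
have := solution_cvg s i st; rewrite -cvg_shiftS/= => lim1.
exact: (cvg_unique (@Rhausdorff R) lim1 lim2).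
Qed.

End CaratheodorySolutions.

Lemma measurable_velocity (R : realType) (n nu nd : nat)
    (U : set 'rV[R]_nu) (D : set 'rV[R]_nd) (g : dynamics R n nu nd) (t : R)
    (u : R -> 'rV[R]_nu) (d : R -> 'rV[R]_nd) (x : R -> 'rV[R]_n) :
  unif_continuous_on U D g -> signal U t u -> signal D t d ->
  (forall i, measurable_fun `[t, 0] (fun r => x r 0 i)) ->
  forall i, measurable_fun `[t, 0] (velocity g u d x i).
Proof.
move=> ucg [mu uU] [md dD] mx i.
pose w (j : 'I_n + 'I_nu + 'I_nd) (r : R) : R :=
  match j with
  | inl (inl k) => x r 0 k
  | inl (inr k) => u r 0 k
  | inr k => d r 0 k
  end.
apply: (@measurable_unif_cont_family _ _ _ _ _ w) => //.
  by case=> [[k|k]|k]; [exact: mx|exact: mu|exact: md].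
move=> e e0; have [delta delta0 gdelta] := ucg e e0.
exists delta => // r r' rt r't close.
apply: le_lt_trans (norm_coordB_le _ _ _ _ i) _.
apply: gdelta; [exact: uU|exact: uU|exact: dD|exact: dD|..];
  apply: norm_lt_coord => // k; rewrite !mxE.
- exact: (close (inl (inl k))).
- exact: (close (inl (inr k))).
- exact: (close (inr k)).
Qed.

(** * Projection of trajectories *)

Section Projection.
Context {R : realType} {n m nu nd : nat}.
Context (sigma : 'I_m -> 'I_n) (U : set 'rV[R]_nu) (D : set 'rV[R]_nd)
  (f : dynamics R n nu nd) (g : dynamics R m nu nd) (t : R)
  (sigma_inj : injective sigma)
  (f_g : forall z u d, U u -> D d ->
    g (colsub sigma z) u d = colsub sigma (f z u d)).

Definition extend0 (x : 'rV[R]_m) : 'rV[R]_n :=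
  \row_j oapp (x 0) 0 [pick i | sigma i == j].

Lemma extend0K x : colsub sigma (extend0 x) = x.
Proof.
apply/rowP => i; rewrite !mxE; case: pickP => [j /eqP/sigma_inj ->//|/(_ i)].
by rewrite eqxx.
Qed.

Lemma norm_colsub (z : 'rV[R]_n) : `|colsub sigma z| <= `|z|.
Proof. by apply: norm_le_coord => // i; rewrite mxE norm_coord_le. Qed.

Lemma norm_extend0B x y : `|extend0 x - extend0 y| <= `|x - y|.
Proof.
apply: norm_le_coord => // j; rewrite !mxE; case: pickP => [i _|_] /=.
  exact: norm_coordB_le.
by rewrite subrr normr0.
Qed.

Lemma bounded_on_colsub : bounded_on U D f -> bounded_on U D g.
Proof.
move=> [M fM]; exists M => x u d Uu Dd; rewrite -(extend0K x) f_g//.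
exact: le_trans (norm_colsub _) (fM _ _ _ Uu Dd).
Qed.

Lemma lipschitz_on_colsub : lipschitz_in_state U D f ->
  exists L, forall u d, U u -> D d -> forall x y,
    `|g x u d - g y u d| <= L * `|x - y|.
Proof.
move=> [L fL]; exists `|L| => u d Uu Dd x y.
rewrite -{1}(extend0K x) -{1}(extend0K y) !f_g//.
rewrite -raddfB; apply: le_trans (norm_colsub _) _.
have := fL u d Uu Dd (extend0 x, extend0 y) (conj Logic.I Logic.I).
move=> /le_trans; apply=> /=.
apply: (@le_trans _ _ (`|L| * `|extend0 x - extend0 y|)).
  by rewrite ler_wpM2r// ler_norm.
by rewrite ler_wpM2l// norm_extend0B.
Qed.

Lemma is_trajectory_colsub z u d x :
  (forall r, r \in `[t, 0] -> U (u r)) ->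
  (forall r, r \in `[t, 0] -> D (d r)) ->
  is_trajectory f t z u d x ->
  is_trajectory g t (colsub sigma z) u d (fun s => colsub sigma (x s)).
Proof.
move=> uU dD xP i; have [ix xE] := xP (sigma i).
have vE r : r \in `[t, 0] ->
    g (colsub sigma (x r)) (u r) (d r) 0 i = f (x r) (u r) (d r) 0 (sigma i).
  by move=> rt; rewrite f_g ?mxE//; [exact: uU|exact: dD].
split=> [|s st].
  apply: eq_integrable ix => // r; rewrite inE => rt.
  by rewrite vE.
rewrite !mxE xE//; congr (_ + _); apply: eq_Rintegral => r; rewrite inE => rs.
rewrite /= vE//; move: rs st; rewrite /= !in_itv/= => /andP[-> rs] /andP[_].
exact: le_trans.
Qed.

(** The full system has a solution, its projection solves the subsystem, and the
    subsystem has no other solution on [[t, 0]]. *)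
Lemma trajectory_colsub z u d :
  unif_continuous_on U D f -> bounded_on U D f -> lipschitz_in_state U D f ->
  signal U t u -> signal D t d ->
  forall s, s \in `[t, 0] ->
  trajectory g t (colsub sigma z) u d s = colsub sigma (trajectory f t z u d s).
Proof.
move=> ucf bf lf su sd s st.
have [[M fM] [L fL]] := (bf, lf).
have [M' gM] := bounded_on_colsub bf.
have [L' gL] := lipschitz_on_colsub lf.
have [[_ uU] [_ dD]] := (su, sd).
have xP : is_trajectory f t z u d (trajectory f t z u d).
  apply: xgetPex; apply: (@trajectory_exists _ _ _ _ _ _ _ _ _ M L).
  - by move=> a r rt; apply: fM; [exact: uU|exact: dD].
  - move=> a b r rt.
    exact: (fL _ _ (uU r rt) (dD r rt) (a, b) (conj Logic.I Logic.I)).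
  - by move=> x mx; exact: (measurable_velocity _ _ _ _ U D).
have yP := is_trajectory_colsub _ _ _ _ uU dD xP.
have gP : is_trajectory g t (colsub sigma z) u d
    (trajectory g t (colsub sigma z) u d) by exact: xgetPex (ex_intro _ _ yP).
apply: (@trajectory_unique _ _ _ _ _ _ _ _ _ M' L' _ _ _ _ gP yP) => //.
- by move=> a r rt; apply: gM; [exact: uU|exact: dD].
- by move=> a b r rt; apply: gL; [exact: uU|exact: dD].
Qed.

(** Both tubes quantify over the same strategies and controls, so a control that
    steers the subsystem into its target is used unchanged for the full
    system. *)
Lemma max_brt_colsub (T : set 'rV[R]_n) (T' : set 'rV[R]_m) z :
  unif_continuous_on U D f -> bounded_on U D f -> lipschitz_in_state U D f ->
  (forall a, T' (colsub sigma a) -> T a) ->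
  max_brt g U D T' t (colsub sigma z) -> max_brt f U D T t z.
Proof.
move=> ucf bf lf T'T zR gamma sgamma.
have [u [su [s st Ts]]] := zR gamma sgamma.
exists u; split=> //; exists s => //; apply: T'T.
by rewrite -trajectory_colsub//; case: sgamma => + _; apply.
Qed.

End Projection.

(** * The two subsystems *)

Definition index1 (n1 n2 nc : nat) (k : 'I_(n1 + nc)) : 'I_(n1 + n2 + nc) :=
  match fintype.split k with
  | inl i => lshift nc (lshift n2 i)
  | inr i => rshift (n1 + n2) i
  end.

Definition index2 (n1 n2 nc : nat) (k : 'I_(n2 + nc)) : 'I_(n1 + n2 + nc) :=
  match fintype.split k with
  | inl i => lshift nc (rshift n1 i)
  | inr i => rshift (n1 + n2) i
  end.

Lemma index1_inj (n1 n2 nc : nat) : injective (index1 n1 n2 nc).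
Proof.
move=> i j; rewrite /index1.
case: (fintype.splitP i) => k ik; case: (fintype.splitP j) => l jl;
  move=> /(congr1 val)/= kl;
  apply: val_inj => /=; rewrite ik jl//=.
- by have := ltn_ord k; rewrite kl -addnA ltnNge leq_addr.
- by have := ltn_ord l; rewrite -kl -addnA ltnNge leq_addr.
- by congr (_ + _)%N; apply: (@addnI (n1 + n2)).
Qed.

Lemma index2_inj (n1 n2 nc : nat) : injective (index2 n1 n2 nc).
Proof.
move=> i j; rewrite /index2.
case: (fintype.splitP i) => k ik; case: (fintype.splitP j) => l jl;
  move=> /(congr1 val)/= kl;
  apply: val_inj => /=; rewrite ik jl//=.
- exact: (@addnI n1).
- by have := ltn_ord k; rewrite -(ltn_add2l n1) kl ltnNge leq_addr.
- by have := ltn_ord l; rewrite -(ltn_add2l n1) -kl ltnNge leq_addr.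
- by congr (_ + _)%N; apply: (@addnI (n1 + n2)).
Qed.

Lemma colsub_index1 (R : realType) (n1 n2 nc : nat)
    (z : 'rV[R]_(n1 + n2 + nc)) :
  colsub (index1 n1 n2 nc) z = row_mx (state1 z) (statec z).
Proof.
apply/rowP => k; rewrite !mxE /index1.
by case: fintype.splitP => i _; rewrite !mxE.
Qed.

Lemma colsub_index2 (R : realType) (n1 n2 nc : nat)
    (z : 'rV[R]_(n1 + n2 + nc)) :
  colsub (index2 n1 n2 nc) z = row_mx (state2 z) (statec z).
Proof.
apply/rowP => k; rewrite !mxE /index2.
by case: fintype.splitP => i _; rewrite !mxE.
Qed.

Theorem corollary7 (R : realType) (n1 n2 nc nu nd : nat)
    (U : set 'rV[R]_nu) (D : set 'rV[R]_nd)
    (f : dynamics R (n1 + n2 + nc) nu nd)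
    (f1 : 'rV[R]_n1 -> 'rV[R]_nc -> 'rV[R]_nu -> 'rV[R]_nd -> 'rV[R]_n1)
    (f2 : 'rV[R]_n2 -> 'rV[R]_nc -> 'rV[R]_nu -> 'rV[R]_nd -> 'rV[R]_n2)
    (fc : 'rV[R]_nc -> 'rV[R]_nu -> 'rV[R]_nd -> 'rV[R]_nc)
    (T : set 'rV[R]_(n1 + n2 + nc))
    (T1 : set 'rV[R]_(n1 + nc)) (T2 : set 'rV[R]_(n2 + nc)) (t : R)
    (n1_gt0 : (0 < n1)%N) (n2_gt0 : (0 < n2)%N)
    (cptU : compact U) (bndD : bounded_set D)
    (ucf : unif_continuous_on U D f) (bndf : bounded_on U D f)
    (lipf : lipschitz_in_state U D f)
    (f_coupled : coupled_form U D f f1 f2 fc)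
    (t_lt0 : t < 0)
    (T_eq : T = back_proj1 T1 `|` back_proj2 T2) :
  back_proj1 (max_brt (subsystem f1 fc) U D T1 t) `|`
  back_proj2 (max_brt (subsystem f2 fc) U D T2 t)
  `<=` max_brt f U D T t.
Proof.
move=> z; rewrite /back_proj1 /back_proj2 /= T_eq.
case; rewrite -?colsub_index1 -?colsub_index2; apply: max_brt_colsub => //.
- exact: index1_inj.
- move=> a u d Uu Dd; have [e1 _ ec] := f_coupled a u d Uu Dd.
  by rewrite !colsub_index1 /subsystem row_mxKl row_mxKr e1 ec.
- by move=> a; rewrite colsub_index1; left.
- exact: index2_inj.
- move=> a u d Uu Dd; have [_ e2 ec] := f_coupled a u d Uu Dd.
  by rewrite !colsub_index2 /subsystem row_mxKl row_mxKr e2 ec.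
- by move=> a; rewrite colsub_index2; right.
Qed.
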